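(* Let $G$ be a finite group and let $H$ be a subgroup of $G$. Then the following are equivalent: (a) $H$ is a perfect code of $G$; (b) there exists an inverse-closed right transversal of $H$ in $G$; (c) for each $x\in G$ such that $x^2\in H$ and $|H|/|H\cap H^x|$ is odd, there exists $y\in Hx$ such that $y^2=e$; (d) for each $x\in G$ such that $HxH=Hx^{-1}H$ and $|H|/|H\cap H^x|$ is odd, there exists $y\in Hx$ such that $y^2=e$.
   Context: All groups and graphs are finite; graphs are undirected and simple. $e$ denotes the identity element, and $H^x=x^{-1}Hx$. For a group $G$ and an inverse-closed subset $S\subseteq G\setminus\{e\}$, the Cayley graph $\mathrm{Cay}(G,S)$ has vertex set $G$, with $x,y$ adjacent iff $yx^{-1}\in S$. A subset $C$ of the vertex set of a graph $\Gamma$ is a perfect code in $\Gamma$ if every vertex of $\Gamma$ is at distance at most $1$ from exactly one vertex of $C$. A subset $C$ of a group $G$ is a perfect code of $G$ if $C$ is a perfect code in some Cayley graph of $G$. A right transversal of $H$ in $G$ is a set containing exactly one element of each right coset $Hx$; it is inverse-closed if it contains the inverse of each of its elements. *)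

(* Defs.v *)
From mathcomp Require Import all_boot all_fingroup.

Set Implicit Arguments.
Unset Strict Implicit.
Unset Printing Implicit Defensive.

Import GroupScope.

Record sgraph (T : finType) := SGraph {
  vertices : {set T};
  adj : rel T;
  adj_vertices : forall x y, adj x y -> (x \in vertices) && (y \in vertices);
  adj_sym : symmetric adj;
  adj_irr : irreflexive adj }.

(* [path (adj Gamma) x p] with [last x p = y] is a walk of length [size p]
   from x to y, so this says that the graph distance from x to y is at most k. *)
Definition dist_at_most (T : finType) (Gamma : sgraph T) (k : nat) (x y : T) :=
  exists p : seq T, [/\ path (adj Gamma) x p, last x p = y & size p <= k].

Definition perfect_code_in (T : finType) (Gamma : sgraph T) (C : {set T}) :=
  C \subset vertices Gamma /\
  forall v, v \in vertices Gamma ->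
    exists! c, c \in C /\ dist_at_most Gamma 1 v c.

Definition inverse_closed (gT : finGroupType) (S : {set gT}) : Prop :=
  {in S, forall x, x^-1 \in S}.

Definition connection_set (gT : finGroupType) (G S : {set gT}) : Prop :=
  S \subset G :\ 1 /\ inverse_closed S.

Definition cayley_adj (gT : finGroupType) (G S : {set gT}) : rel gT :=
  fun x y => [&& x \in G, y \in G & y * x^-1 \in S].

Lemma cayley_adj_vertices (gT : finGroupType) (G S : {set gT}) x y :
  cayley_adj G S x y -> (x \in G) && (y \in G).
Proof. by case/and3P=> -> ->. Qed.

Lemma cayley_adj_sym (gT : finGroupType) (G S : {set gT}) :
  connection_set G S -> symmetric (cayley_adj G S).
Proof.
case=> _ SV x y; rewrite /cayley_adj andbCA; do 2!congr (_ && _).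
by apply/idP/idP=> /SV; rewrite invMg invgK.
Qed.

Lemma cayley_adj_irr (gT : finGroupType) (G S : {set gT}) :
  connection_set G S -> irreflexive (cayley_adj G S).
Proof.
case=> /subsetP sSG _ x; apply/and3P=> -[_ _]; rewrite mulgV => /sSG.
by rewrite !inE eqxx.
Qed.

Definition Cay (gT : finGroupType) (G S : {set gT})
    (GS : connection_set G S) : sgraph gT :=
  SGraph (@cayley_adj_vertices gT G S) (cayley_adj_sym GS) (cayley_adj_irr GS).

Definition perfect_code_of (gT : finGroupType) (G : {group gT})
    (C : {set gT}) : Prop :=
  exists (S : {set gT}) (GS : connection_set G S), perfect_code_in (Cay GS) C.

(* Main.v *)
Require Import Defs.
From mathcomp Require Import all_boot all_fingroup.

Import GroupScope.

(** A perfect code [H] of [Cay(G, S)] is the same thing as an inverse-closed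
  right transversal [1 |: S], up to replacing by [1] the representative of
  [H].  The double coset [HxH] contains [|H| / |H :&: H^x|] right cosets of
  [H]; if this number is odd and [HxH] is inverse-closed, inversion fixes an
  element of an inverse-closed transversal inside [HxH], and a conjugate of
  this element lies in [Hx].  Conversely, every right coset in [HxH] meets
  the inverse of every right coset in [Hx^-1H], so an inverse-closed partial
  transversal missing a coset can be enlarged, either by a pair [t, t^-1], or
  by a solution of [y ^+ 2 = 1], or by trading such a solution for a pair;
  which case applies depends on the parity of the number of cosets. *)

Section InverseClosedTransversals.

Variable gT : finGroupType.
Implicit Types (G H : {group gT}) (A B T : {set gT}) (x y z t : gT).

(** * Parity of inverse-closed sets *)

Lemma inverse_closed_odd A :
  inverse_closed A -> odd #|A| -> exists2 y, y \in A & y ^+ 2 = 1.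
Proof.
have [n] := ubnP #|A|; elim: n A => // n IHn A; rewrite ltnS => leAn AV oddA.
have [x Ax] : exists x, x \in A by apply/card_gt0P; case: #|A| oddA.
have [x2|x2] := eqVneq (x ^+ 2) 1; first by exists x.
have neqV : x^-1 != x.
  by apply: contraNneq x2 => xV; rewrite expgS expg1 -{1}xV mulVg.
(* Deleting the pair [x], [x^-1] preserves both parity and closure under inverses. *)
pose B := A :\ x :\ x^-1.
have cardA : #|A| = #|B|.+2.
  by rewrite (cardsD1 x A) Ax (cardsD1 x^-1 (A :\ x)) !inE neqV AV.
have [|||y] := IHn B.
- by move: leAn; rewrite cardA => /ltnW.
- move=> y; rewrite !inE => /and3P[yV yx Ay].
  by rewrite (inj_eq invg_inj) yx AV // (canF_eq invgK) yV.
- by move: oddA; rewrite cardA /= negbK.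
by rewrite !inE => /and3P[_ _ Ay] y2; exists y.
Qed.

(** * Double cosets and their cardinals *)

Lemma dcosetP {H x y} :
  reflect (exists h k, [/\ h \in H, k \in H & y = h * x * k])
          (y \in H :* x * H).
Proof.
apply: (iffP imset2P) => [[_ k /rcosetP[h Hh ->] Hk ->]|[h [k [Hh Hk ->]]]].
  by exists h, k.
by exists (h * x) k; rewrite // mem_rcoset mulgK.
Qed.

Lemma dcoset_refl H x : x \in H :* x * H.
Proof. by apply/dcosetP; exists 1, 1; rewrite group1 mul1g mulg1. Qed.

Lemma dcoset_eqP {H x y} : y \in H :* x * H -> H :* y * H = H :* x * H.
Proof.
case/dcosetP=> h [k [Hh Hk ->]].
by rewrite !rcosetM (rcoset_id Hh) -mulgA lcoset_id.
Qed.

Lemma mem_dcosetV H x y : (y^-1 \in H :* x * H) = (y \in H :* x^-1 * H).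
Proof.
apply/dcosetP/dcosetP=> -[h [k [Hh Hk def_y]]];
  exists k^-1, h^-1; rewrite !groupV; split=> //.
  by rewrite -[y]invgK def_y !invMg mulgA.
by rewrite def_y !invMg invgK mulgA.
Qed.

Lemma mem_dcosetl H x y h :
  h \in H -> (h * y \in H :* x * H) = (y \in H :* x * H).
Proof.
move=> Hh; apply/dcosetP/dcosetP=> -[h1 [k [Hh1 Hk def_y]]].
  by exists (h^-1 * h1), k; rewrite groupM ?groupV // -(mulKg h y) def_y !mulgA.
by exists (h * h1), k; rewrite groupM // def_y !mulgA.
Qed.

(** Left translation by [x^-1] gives the product [H :^ x * H], to which the product formula applies;
    the quotient is the number of right cosets of [H] in the double coset. *)
Lemma card_dcoset H x :
  #|H :* x * H| = (#|H| * (#|H| %/ #|H :&: H :^ x|))%N.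
Proof.
have -> : H :* x * H = x *: (H :^ x * H).
  by rewrite conjsgE -!mulgA -[RHS]lcosetM mulgV lcoset1.
have cardI_gt0 : 0 < #|H :&: H :^ x| by apply: cardG_gt0.
rewrite card_lcoset muln_divA ?cardSg ?subsetIl //.
by rewrite -{2}(cardJg H x) mulnC mul_cardG setIC mulnK.
Qed.

Lemma card_dcosetV H x : #|H :* x^-1 * H| = #|H :* x * H|.
Proof.
rewrite -(card_imset (mem (H :* x^-1 * H)) invg_inj); apply: eq_card => y.
by rewrite -{1}[y]invgK (mem_imset _ _ invg_inj) mem_dcosetV invgK.
Qed.

(** * Partial right transversals, counted inside double cosets *)

Definition coset_separated H T := {in T &, forall s t, s * t^-1 \in H -> s = t}.

Lemma coset_separatedS H A B :
  A \subset B -> coset_separated H B -> coset_separated H A.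
Proof. by move=> /subsetP sAB sepB s t /sAB Bs /sAB; apply: sepB. Qed.

Lemma coset_separatedU1 H A x :
    coset_separated H A -> {in A, forall t, t \notin H :* x} ->
  coset_separated H (x |: A).
Proof.
move=> sepA xA s t; rewrite !inE => /predU1P[->|As] /predU1P[->|At] // Hst.
- by case/negP: (xA _ At); rewrite mem_rcoset -groupV invMg invgK.
- by case/negP: (xA _ As); rewrite mem_rcoset.
exact: sepA.
Qed.

Lemma card_mul_separated H A :
  coset_separated H A -> #|H * A| = (#|H| * #|A|)%N.
Proof.
move=> sepA; rewrite -cardsX [H * A]curry_imset2X card_in_imset //.
move=> [h s] [k t]; rewrite !inE /= => /andP[Hh As] /andP[Hk At] eq_hk.
have def_s : s = h^-1 * k * t by rewrite -mulgA -eq_hk mulKg.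
have eq_st : s = t by apply: sepA => //; rewrite def_s mulgK groupM ?groupV.
by move: eq_hk; rewrite eq_st => /mulIg->.
Qed.

Lemma mul_sub_dcoset H A x : A \subset H :* x * H -> H * A \subset H :* x * H.
Proof. by move/(mulgS H); rewrite !mulgA mulGid. Qed.

Lemma leq_card_separated H A x :
    coset_separated H A -> A \subset H :* x * H ->
  #|H| * #|A| <= #|H :* x * H|.
Proof.
move=> sepA sAD.
by rewrite -card_mul_separated // subset_leq_card ?mul_sub_dcoset.
Qed.

Lemma eq_card_separated H A x :
    coset_separated H A -> A \subset H :* x * H ->
    {in H :* x * H, forall y, exists2 t, t \in A & t \in H :* y} ->
  (#|H| * #|A|)%N = #|H :* x * H|.
Proof.
move=> sepA sAD covA; rewrite -card_mul_separated //; congr #|pred_of_set _|.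
apply/eqP; rewrite eqEsubset mul_sub_dcoset //=.
apply/subsetP=> y /covA[t At]; rewrite mem_rcoset => Hty.
have -> : y = (t * y^-1)^-1 * t by rewrite invMg invgK mulgKV.
by rewrite mem_mulg ?groupV.
Qed.

Lemma transversalP {G H T} : H \subset G ->
  reflect [/\ T \subset G, coset_separated H T &
             {in G, forall x, exists2 t, t \in T & t \in H :* x}]
          (is_transversal T (rcosets H G) G).
Proof.
move=> sHG; rewrite /is_transversal rcosets_partition //=.
apply: (iffP andP) => [[sTG /forall_inP T1]|[sTG sepT covT]]; split=> //.
- move=> s t Ts Tt Hst; have Gt := subsetP sTG t Tt.
  have /T1/cards1P[u def_u] : H :* t \in rcosets H G by apply/rcosetsP; exists t.
  have : s \in [set u] by rewrite -def_u !inE Ts mem_rcoset.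
  have : t \in [set u] by rewrite -def_u !inE Tt rcoset_refl.
  by rewrite !inE => /eqP-> /eqP->.
- move=> x Gx.
  have /T1/cards1P[u def_u] : H :* x \in rcosets H G by apply/rcosetsP; exists x.
  by exists u; have: u \in [set u] by [rewrite inE]; rewrite -def_u => /setIP[].
apply/forall_inP=> _ /rcosetsP[x /covT[t Tt Hxt] ->]; apply/cards1P; exists t.
apply/setP=> s; rewrite !inE; apply/andP/eqP=> [[Ts Hxs]|-> //].
by apply: sepT; rewrite // -mem_rcoset (rcoset_eqP Hxt).
Qed.

(** * Perfect codes and inverse-closed transversals *)

Lemma dist_at_most_Cay {G A} (GA : connection_set G A) v c :
    v \in G -> c \in G ->
  dist_at_most (Cay GA) 1 v c <-> c * v^-1 \in 1 |: A.
Proof.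
move=> Gv Gc; rewrite !inE; split=> [[[|d [|d' p]] []] //|/predU1P[eq_cv|Scv]].
- by move=> _ /= -> _; rewrite mulgV eqxx.
- by rewrite /= andbT => /and3P[_ _ Sdv] <- _; rewrite Sdv orbT.
- by exists [::]; split=> //=; rewrite -[c](mulgKV v) eq_cv mul1g.
by exists [:: c]; split=> //=; rewrite /cayley_adj Gv Gc Scv.
Qed.

(** The vertices within distance 1 of [x^-1] are the [s * x^-1] with [s] in [1 |: S], and such a
    vertex is in [H] iff [s] is in [H :* x]. *)
Lemma perfect_code_transversal G H : H \subset G -> perfect_code_of G H ->
  exists T, is_transversal T (rcosets H G) G /\ inverse_closed T.
Proof.
move=> sHG [S [GS [/= _ codeH]]]; have [sSG SV] := GS.
have sSG' : S \subset G by apply: subset_trans sSG (subD1set _ _).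
exists (1 |: S); split; last first.
  by move=> t; rewrite !inE => /predU1P[->|/SV->]; rewrite ?invg1 ?eqxx ?orbT.
have sTG : 1 |: S \subset G by rewrite subUset sub1set group1.
apply/(transversalP sHG); split=> // [s t Ts Tt Hst|x Gx].
  have Gt := subsetP sTG t Tt.
  (* Both [1] and [s * t^-1] are code elements near [t^-1], reached through [t] and [s]. *)
  have [|c [_ c_uniq]] := codeH t^-1; first by rewrite groupV.
  apply: (mulIg t^-1); rewrite mulgV.
  apply: etrans (esym (c_uniq _ _)) (c_uniq _ _); split=> //.
    by apply/dist_at_most_Cay; rewrite ?groupV ?(subsetP sHG _ Hst) // invgK mulgKV.
  by apply/dist_at_most_Cay; rewrite ?groupV ?group1 // invgK mul1g.
have [|c [[Hc dc] _]] := codeH x^-1; first by rewrite groupV.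
exists (c * x); last by rewrite mem_rcoset mulgK.
have Gc := subsetP sHG c Hc.
by case: (dist_at_most_Cay GS x^-1 c) => [||/(_ dc)]; rewrite ?invgK ?groupV.
Qed.

(* The representative of [H] in [T] need not be [1], so the connection set is
   [T :\: H] rather than [T :\ 1]. *)
Lemma transversal_perfect_code G H T :
    H \subset G -> is_transversal T (rcosets H G) G -> inverse_closed T ->
  perfect_code_of G H.
Proof.
move=> sHG /(transversalP sHG)[sTG sepT covT] TV.
have GS : connection_set G (T :\: H).
  split=> [|t]; last by rewrite !inE groupV => /andP[-> /TV].
  apply/subsetP=> t; rewrite !inE => /andP[Ht /(subsetP sTG)->]; rewrite andbT.
  by apply: contraNneq Ht => ->.
exists (T :\: H), GS; split=> //= v Gv.
have [Hv|H'v] := boolP (v \in H).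
  exists v; split=> [|c [Hc /(dist_at_most_Cay GS v c Gv (subsetP sHG c Hc))]].
    by split=> //; apply/dist_at_most_Cay; rewrite // mulgV !inE eqxx.
  rewrite !inE => /predU1P[eq_cv|/andP[/negP[]]]; last by rewrite groupM ?groupV.
  by rewrite -[c](mulgKV v) eq_cv mul1g.
(* The representative [t] of [H :* v^-1] leads from [v] to [t * v] in [H]. *)
have [|t Tt] := covT v^-1; first by rewrite groupV.
rewrite mem_rcoset invgK => Htv; exists (t * v); split.
  split=> //; apply/dist_at_most_Cay; rewrite ?(subsetP sHG _ Htv) // mulgK.
  by rewrite !inE Tt andbT (contra _ H'v) ?orbT // => Ht; rewrite -(groupMl v Ht).
move=> c [Hc /(dist_at_most_Cay GS v c Gv (subsetP sHG c Hc))].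
rewrite !inE => /predU1P[eq_cv|/andP[_ Tcv]].
  by rewrite -[c](mulgKV v) eq_cv mul1g in Hc; rewrite Hc in H'v.
rewrite -[c](mulgKV v); congr (_ * v); apply: sepT => //.
by rewrite invMg invgK mulgA groupM ?groupV.
Qed.

(** * Elements of [H :* x] with square [1] or square in [H] *)

Lemma transversal_sqr1 G H T x :
    H \subset G -> is_transversal T (rcosets H G) G -> inverse_closed T ->
    x \in G -> x ^+ 2 \in H -> odd (#|H| %/ #|H :&: H :^ x|) ->
  exists y, y \in H :* x /\ y ^+ 2 = 1.
Proof.
move=> sHG /(transversalP sHG)[sTG sepT covT] TV Gx Hx2 oddH.
pose D := H :* x * H.
(* Here [x^-1 = (x ^+ 2)^-1 * x] is in [H :* x]. *)
have DV : H :* x^-1 * H = D.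
  apply: dcoset_eqP; apply/dcosetP; exists (x ^+ 2)^-1, 1.
  by rewrite groupV Hx2 group1 mulg1 expgS expg1 invMg mulgKV.
have [||y] := inverse_closed_odd (T :&: D).
- by move=> t; rewrite !inE mem_dcosetV DV => /andP[/TV->].
- suffices: (#|H| * #|T :&: D| == #|H| * (#|H| %/ #|H :&: H :^ x|))%N.
    by rewrite eqn_pmul2l ?cardG_gt0 // => /eqP->.
  rewrite -card_dcoset; apply/eqP; apply: eq_card_separated.
  + exact: coset_separatedS (subsetIl _ _) sepT.
  + exact: subsetIr.
  move=> y Dy; have [|t Tt Hyt] := covT y.
    case/dcosetP: Dy => h [k [/(subsetP sHG)Gh /(subsetP sHG)Gk ->]].
    by rewrite !groupM.
  exists t => //; rewrite inE Tt.
  by case/rcosetP: Hyt => h Hh ->; rewrite mem_dcosetl.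
case/setIP=> _ /dcosetP[h [k [Hh Hk def_y]]] y2.
(* Conjugating [y = h * x * k] by [k^-1] gives [k * h * x]. *)
exists (y ^ k^-1); rewrite -conjXg y2 conj1g; split=> //.
by rewrite def_y conjgE invgK !mulgA mulgK mem_rcoset mulgK groupM.
Qed.

(* Self-pairedness of the orbital of [(H, Hx)]: some element of [Hx] swaps the
   cosets [H] and [Hx], and its square therefore lies in [H]. *)
Lemma dcoset_sym_sqr H x : H :* x * H = H :* x^-1 * H ->
  exists2 z, z \in H :* x & z ^+ 2 \in H.
Proof.
move=> eqD; have: x^-1 \in H :* x * H by rewrite eqD dcoset_refl.
case/dcosetP=> h [k [Hh Hk def_xV]].
(* From [x^-1 = h * x * k] follows [x * k * x = h^-1], so the square of [k * x] is [k * h^-1]. *)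
exists (k * x); first by rewrite mem_rcoset mulgK.
have xk : x * k = h^-1 * x^-1 by rewrite def_xV -mulgA mulKg.
by rewrite expgS expg1 -mulgA (mulgA x) xk mulgKV groupM ?groupV.
Qed.

(** * Enlarging inverse-closed partial transversals *)

Lemma add_inverse_pair G H T x x' :
    H \subset G -> T \subset G -> coset_separated H T -> inverse_closed T ->
    x \in G -> x' \in H :* x^-1 * H -> x' \notin H :* x ->
    {in T, forall t, t \notin H :* x} -> {in T, forall t, t \notin H :* x'} ->
  exists T', [/\ T' \subset G, coset_separated H T', inverse_closed T'
               & #|T'| = #|T|.+2].
Proof.
move=> sHG sTG sepT TV Gx /dcosetP[h [k [Hh Hk def_x']]] Hxx' Tx Tx'.
(* Since [x' = h * x^-1 * k], this [t] represents [H :* x] while [t^-1 = x^-1 * k] represents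
   [H :* x']. *)
pose t := k^-1 * x.
have Ht : H :* t = H :* x.
  by apply/rcoset_eqP; rewrite mem_rcoset mulgK groupV.
have HtV : H :* t^-1 = H :* x'.
  apply/esym/rcoset_eqP.
  by rewrite mem_rcoset def_x' invMg invgK -[h * _ * k]mulgA mulgK.
have Gt : t \in G by rewrite groupM ?groupV // (subsetP sHG).
have Ut : t^-1 \notin t |: T.
  rewrite !inE negb_or; apply/andP; split; last first.
    by apply/negP=> /Tx'; rewrite -HtV rcoset_refl.
  by apply: contra Hxx' => /eqP eq_t; rewrite -Ht -eq_t HtV rcoset_refl.
exists (t^-1 |: (t |: T)); split.
- by rewrite !subUset !sub1set groupV Gt.
- apply: coset_separatedU1; first by apply: coset_separatedU1; rewrite ?Ht.
  move=> s; rewrite HtV !inE => /predU1P[->|/Tx' //].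
  by apply: contra Hxx' => /rcoset_eqP eq_t; rewrite -Ht eq_t rcoset_refl.
- move=> s; rewrite !inE => /or3P[/eqP->|/eqP->|/TV->];
    by rewrite ?invgK ?eqxx ?orbT.
rewrite cardsU1 Ut cardsU1; have -> // : t \notin T.
by apply/negP=> /Tx; rewrite -Ht rcoset_refl.
Qed.

Lemma extend_partial_transversal G H T x :
    H \subset G ->
    (forall z, z \in G -> H :* z * H = H :* z^-1 * H ->
       odd (#|H| %/ #|H :&: H :^ z|) -> exists y, y \in H :* z /\ y ^+ 2 = 1) ->
    T \subset G -> coset_separated H T -> inverse_closed T ->
    x \in G -> {in T, forall t, t \notin H :* x} ->
  exists T', [/\ T' \subset G, coset_separated H T', inverse_closed T'
               & #|T| < #|T'|].
Proof.
move=> sHG oddP sTG sepT TV Gx Tx.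
pose D := H :* x * H; pose D' := H :* x^-1 * H.
(* A missed right coset in [D'] other than [H :* x] allows a pair to be added. Otherwise [T] meets
   every right coset in [D'] other than [H :* x]. *)
case: (pickP [pred x' in D' | (x' \notin H :* x) && [disjoint T & H :* x']]).
  move=> x' /and3P[/= D'x' Hxx' /pred0P dis].
  have Tx' : {in T, forall t, t \notin H :* x'}.
    by move=> t Tt; apply/negP=> Ht; have:= dis t; rewrite /= Tt Ht.
  have [T' [sT' sepT' T'V cardT']] :=
    add_inverse_pair _ _ _ _ _ sHG sTG sepT TV Gx D'x' Hxx' Tx Tx'.
  by exists T'; rewrite cardT'.
move=> noth.
have cov y : y \in D' -> y \notin H :* x -> exists2 t, t \in T & t \in H :* y.
  move=> D'y Hxy; move: (noth y); rewrite /= D'y Hxy /=.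
  by case/negbT/pred0Pn=> t /andP[]; exists t.
have sepTD A : coset_separated H (T :&: A).
  exact: coset_separatedS (subsetIl _ _) sepT.
have sep_xTD : coset_separated H (x |: (T :&: D)).
  by apply: coset_separatedU1 => // t /setIP[/Tx].
have sub_xTD : x |: (T :&: D) \subset D.
  by rewrite subUset sub1set dcoset_refl subsetIr.
have x_notin : x \notin T :&: D.
  by apply/negP=> /setIP[/Tx]; rewrite rcoset_refl.
(* If [x] is not in [D'], then [T] meets all right cosets in [D']; inversion matches [T :&: D'] with
   [T :&: D], so [x |: (T :&: D)] would have more elements than [D] has right cosets. *)
have [Dx|D'x] := boolP (x \in D'); last first.
  have cardTD : #|T :&: D'| = #|T :&: D|.
    rewrite -(card_imset (mem (T :&: D')) invg_inj); apply: eq_card => y.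
    rewrite -{1}[y]invgK (mem_imset _ _ invg_inj) !inE -mem_dcosetV invgK.
    by congr (_ && _); apply/idP/idP=> /TV; rewrite ?invgK.
  have := leq_card_separated H _ x sep_xTD sub_xTD.
  rewrite -card_dcosetV -(eq_card_separated H (T :&: D') x^-1) ?subsetIr //.
    by rewrite cardTD leq_pmul2l ?cardG_gt0 // cardsU1 x_notin ltnn.
  move=> y D'y; have [|t Tt Hyt] := cov y D'y.
    apply: contra D'x => /rcosetP[h Hh def_y].
    by rewrite -(mem_dcosetl H _ x h Hh) -def_y.
  exists t => //; rewrite inE Tt.
  by case/rcosetP: Hyt => h Hh ->; rewrite mem_dcosetl.
have eqD : D = D' by apply: dcoset_eqP.
have [oddH|evenH] := boolP (odd (#|H| %/ #|H :&: H :^ x|)).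
  have [y [Hxy y2]] := oddP x Gx eqD oddH.
  have eqHy : H :* y = H :* x by apply/rcoset_eqP.
  have yV : y^-1 = y by apply: (mulgI y); rewrite mulgV -y2.
  exists (y |: T); split.
  - by rewrite subUset sub1set sTG andbT (subsetP (mul_subG _ _) _ Hxy) ?sub1set.
  - by apply: coset_separatedU1; rewrite // eqHy.
  - by move=> t; rewrite !inE => /predU1P[->|/TV->]; rewrite ?yV ?eqxx ?orbT.
  by rewrite cardsU1; have -> : y \notin T by apply/negP=> /Tx; rewrite Hxy.
(* In [D] only [H :* x] is missed, so [T :&: D] has one element fewer than the even number of
   cosets. *)
have [||z] := inverse_closed_odd (T :&: D).
- by move=> t; rewrite !inE mem_dcosetV -/D' -eqD => /andP[/TV->].
- rewrite -[odd _]negbK -[~~ odd _]/(odd #|T :&: D|.+1).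
  suffices <- : #|H| %/ #|H :&: H :^ x| = #|T :&: D|.+1 by [].
  apply/eqP; rewrite -(eqn_pmul2l (cardG_gt0 H)) -card_dcoset eq_sym.
  have <- : #|x |: (T :&: D)| = #|T :&: D|.+1 by rewrite cardsU1 x_notin.
  apply/eqP; apply: eq_card_separated => // y Dy.
  have [Hxy|Hxy] := boolP (y \in H :* x).
    by exists x; [rewrite !inE eqxx | rewrite rcoset_sym].
  have [||t Tt Hyt] := cov y; rewrite -?eqD //.
  exists t => //; rewrite !inE Tt.
  by case/rcosetP: Hyt => h Hh ->; rewrite mem_dcosetl // Dy orbT.
case/setIP=> Tz Dz z2.
have zV : z^-1 = z by apply: (mulgI z); rewrite mulgV -z2.
(* Removing [z] frees its coset; a pair representing [H :* x] and [H :* z] then gives a net gain of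
   one element. *)
have [||||||||T' [sT' sepT' T'V cardT']] :=
  add_inverse_pair G H (T :\ z) x z sHG.
- exact: subset_trans (subD1set _ _) sTG.
- exact: coset_separatedS (subD1set _ _) sepT.
- by move=> t; rewrite !inE => /andP[tz /TV->]; rewrite -zV (inj_eq invg_inj) tz.
- exact: Gx.
- by rewrite -/D' -eqD.
- exact: Tx.
- by move=> t /setD1P[_ /Tx].
- move=> t /setD1P[tz Tt]; apply: contra tz; rewrite mem_rcoset => Htz.
  by rewrite (sepT t z).
by exists T'; split=> //; rewrite cardT' (cardsD1 z T) Tz.
Qed.

(** The extension step is iterated from the empty set. The sets stay inside [G], so [#|G| - #|T|]
    drops each time, until no coset is missed. *)
Lemma exists_inverse_closed_transversal G H :
    H \subset G ->
    (forall x, x \in G -> H :* x * H = H :* x^-1 * H ->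
       odd (#|H| %/ #|H :&: H :^ x|) -> exists y, y \in H :* x /\ y ^+ 2 = 1) ->
  exists T, is_transversal T (rcosets H G) G /\ inverse_closed T.
Proof.
move=> sHG oddP.
suffices ext n T : #|G| - #|T| < n -> T \subset G -> coset_separated H T ->
    inverse_closed T ->
    exists T', is_transversal T' (rcosets H G) G /\ inverse_closed T'.
  by apply: (ext _ set0 (ltnSn _)); rewrite ?sub0set // => ?; rewrite inE.
elim: n T => // n IHn T; rewrite ltnS => leTn sTG sepT TV.
case: (pickP [pred x in G | [disjoint T & H :* x]]) => [x|cov].
  case/andP=> /= Gx /pred0P dis.
  have [|T' [sT' sepT' T'V ltT]] :=
    extend_partial_transversal G H T x sHG oddP sTG sepT TV Gx.
    by move=> t Tt; apply/negP=> Ht; have:= dis t; rewrite /= Tt Ht.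
  apply: (IHn T') => //; apply: leq_trans leTn; apply: ltn_sub2l => //.
  exact: leq_trans ltT (subset_leq_card sT').
exists T; split=> //; apply/(transversalP sHG); split=> // x Gx.
by move: (cov x); rewrite /= Gx => /negbT/pred0Pn[t /andP[]]; exists t.
Qed.

End InverseClosedTransversals.

Theorem theorem1p2 (gT : finGroupType) (G H : {group gT}) (sHG : H \subset G) :
  [<-> perfect_code_of G H;
       exists T : {set gT}, is_transversal T (rcosets H G) G /\ inverse_closed T;
       forall x, x \in G -> x ^+ 2 \in H ->
         odd (#|H| %/ #|H :&: H :^ x|) ->
         exists y, y \in H :* x /\ y ^+ 2 = 1;
       forall x, x \in G -> H :* x * H = H :* x^-1 * H ->
         odd (#|H| %/ #|H :&: H :^ x|) ->
         exists y, y \in H :* x /\ y ^+ 2 = 1].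
Proof.
tfae.
- exact: perfect_code_transversal.
- by move=> [T [trT TV]] x; apply: transversal_sqr1 trT TV.
(* Replacing [x] by [z = h * x] changes neither [H :* x] nor [H :^ x], so parity and conclusion
   carry over. *)
- move=> sqrP x Gx /dcoset_sym_sqr[z /rcosetP[h Hh ->] Hz2] oddH.
  have [||y] := sqrP (h * x) _ Hz2; first by rewrite groupM // (subsetP sHG).
    by rewrite conjsgM conjGid.
  by rewrite rcosetM rcoset_id //; exists y.
move=> oddP.
have [T [trT TV]] := exists_inverse_closed_transversal gT G H sHG oddP.
exact: transversal_perfect_code trT TV.
Qed.
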